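(* Let $T\colon\mathsf{Set}\to\mathsf{Set}$ be a functor that preserves weak pullbacks, and let $\Lambda$ be a set of standard unary (fuzzy) predicate liftings for $T$. Then the Wasserstein lifting $W_\Lambda$ is a converse-preserving fuzzy lax extension of $T$. If additionally all $\lambda\in\Lambda$ are nonexpansive, then $W_\Lambda$ is nonexpansive as well.
   Context: A fuzzy relation between sets $A$ and $B$ is a map $R\colon A\times B\to[0,1]$; fuzzy relations are ordered pointwise, and the converse is $R^\circ(b,a)=R(a,b)$. For $x,y\in[0,1]$: $x\oplus y=\min(x+y,1)$. Composition: $(R;S)(a,c)=\inf_{b\in B}R(a,b)\oplus S(b,c)$ (infima and suprema are taken in $[0,1]$). For $f\colon A\to B$ and $\epsilon\in[0,1]$, $\mathrm{Gr}_{\epsilon,f}(a,b)=\epsilon$ if $f(a)=b$ and $1$ otherwise; $\mathrm{Gr}_f=\mathrm{Gr}_{0,f}$, $\Delta_{\epsilon,A}=\mathrm{Gr}_{\epsilon,\mathrm{id}_A}$. A relation lifting $L$ of $T$ assigns to each fuzzy relation $R$ between $A$ and $B$ (for all sets $A,B$) a fuzzy relation $LR$ between $TA$ and $TB$. It preserves converse if $L(R^\circ)=(LR)^\circ$ for all $R$. It is a fuzzy lax extension if (L1) $R_1\le R_2$ implies $LR_1\le LR_2$; (L2) $L(R;S)\le LR;LS$; (L3) $L\,\mathrm{Gr}_f\le\mathrm{Gr}_{Tf}$ and $L(\mathrm{Gr}_f^\circ)\le\mathrm{Gr}_{Tf}^\circ$ for every function $f$. A fuzzy lax extension is nonexpansive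 if $L\Delta_{\epsilon,A}\le\Delta_{\epsilon,TA}$ for all sets $A$ and all $\epsilon>0$. Write $\mathcal{Q}X$ for the set of functions $X\to[0,1]$, a contravariant functor by precomposition. A unary predicate lifting is a natural transformation $\lambda\colon\mathcal{Q}\Rightarrow\mathcal{Q}\circ T$. It is monotone if $f\le g$ implies $\lambda_X(f)\le\lambda_X(g)$; subadditive if $\lambda_X(f\oplus g)\le\lambda_X(f)\oplus\lambda_X(g)$ for all $X$ and $f,g\in\mathcal{Q}X$ (with $\oplus$ pointwise); it preserves the zero function if $\lambda_X$ sends the constant $0$ function on $X$ to the constant $0$ function on $TX$; it is standard if it is monotone, subadditive and preserves the zero function. It is nonexpansive if $\|\lambda_X(f)-\lambda_X(g)\|_\infty\le\|f-g\|_\infty$ for all $X$ and $f,g\in\mathcal{Q}X$. For $t_1\in TA$, $t_2\in TB$, the set of couplings is $\mathsf{Cpl}(t_1,t_2)=\{t\in T(A\times B)\mid T\pi_1(t)=t_1,\ T\pi_2(t)=t_2\}$. The Wasserstein lifting is, for a fuzzy relation $R$ between $A$ and $B$, $$W_\Lambda R(t_1,t_2)=\sup_{\lambda\in\Lambda}\inf\{\lambda_{A\times B}(R)(t)\mid t\in\mathsf{Cpl}(t_1,t_2)\}.$$ *)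

(* Defs.v *)
From HB Require Import structures.
From mathcomp Require Import all_boot all_order all_algebra.
From mathcomp Require Import all_classical all_reals.
From mathcomp Require Import interval_inference.

Set Implicit Arguments.
Unset Strict Implicit.
Unset Printing Implicit Defensive.

Import Order.TTheory GRing.Theory Num.Theory.
Local Open Scope classical_set_scope.
Local Open Scope ring_scope.

Section UnitInterval.
Variable R : realType.
Implicit Types (x y : {i01 R}) (S : set {i01 R}).

Definition oplus x y : {i01 R} := (Num.min (x%:num + y%:num) 1)%:i01.

Let val01 S : set R := [set x%:num | x in S].

Let val01_ub S : ubound (val01 S) 1.
Proof. by move=> _ [x _ <-]. Qed.

Let val01_lb S : lbound (1 |` val01 S) 0.
Proof. by move=> _ [->|[x _ <-]]. Qed.

Fact sup01_ge0 S : 0 <= sup (val01 S).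
Proof.
have [->|/set0P[x Sx]] := eqVneq (val01 S) set0; first by rewrite sup0.
apply: (@le_trans _ _ x); first by case: Sx => y _ <-.
by apply: ub_le_sup => //; exists 1; exact: val01_ub.
Qed.

Fact sup01_le1 S : sup (val01 S) <= 1.
Proof.
have [->|/set0P S0] := eqVneq (val01 S) set0; first by rewrite sup0.
by apply: ge_sup => //; exact: val01_ub.
Qed.

Fact inf01_ge0 S : 0 <= inf (1 |` val01 S).
Proof. by apply: lb_le_inf; [exists 1; left | exact: val01_lb]. Qed.

Fact inf01_le1 S : inf (1 |` val01 S) <= 1.
Proof. by apply: ge_inf; [exists 0; exact: val01_lb | left]. Qed.

Definition sup01 S : {i01 R} := Itv01 (sup01_ge0 S) (sup01_le1 S).

(* [1] is adjoined because the infimum of the empty set in [0,1] is 1, whereas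
   [inf set0 = 0] in [R]; for suprema [sup set0 = 0] is the right value. *)
Definition inf01 S : {i01 R} := Itv01 (inf01_ge0 S) (inf01_le1 S).

Lemma sup01_ub S x : S x -> x <= sup01 S.
Proof.
move=> Sx; rewrite -num_le /=; apply: ub_le_sup; last by exists x.
by exists 1; exact: val01_ub.
Qed.

Lemma sup01_le S y : (forall x, S x -> x <= y) -> sup01 S <= y.
Proof.
move=> Sy; rewrite -num_le /=.
have [->|/set0P S0] := eqVneq (val01 S) set0; first by rewrite sup0.
by apply: ge_sup => // _ [x Sx <-]; rewrite num_le; exact: Sy.
Qed.

Lemma inf01_lb S x : S x -> inf01 S <= x.
Proof.
move=> Sx; rewrite -num_le /=; apply: ge_inf; last by right; exists x.
by exists 0; exact: val01_lb.
Qed.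

Lemma le_inf01 S y : (forall x, S x -> y <= x) -> y <= inf01 S.
Proof.
move=> yS; rewrite -num_le /=; apply: lb_le_inf; first by exists 1; left.
by move=> _ [->//|[x Sx <-]]; rewrite num_le; exact: yS.
Qed.

End UnitInterval.

(* The objects of the category of sets: the types of one fixed universe. *)
Definition SET := Type.

Record setFunctor := SetFunctor {
  fobj :> SET -> SET ;
  smap : forall A B : SET, (A -> B) -> fobj A -> fobj B ;
  smap_id : forall A : SET, smap (@id A) = id ;
  smap_comp : forall (A B C : SET) (g : B -> C) (f : A -> B),
    smap (g \o f) = smap g \o smap f }.

Arguments smap s {A B} _ _.

Definition weak_pullback (P A B C : SET)
    (p : P -> A) (q : P -> B) (f : A -> C) (g : B -> C) : Prop :=
  f \o p = g \o q /\
  forall (Q : SET) (p' : Q -> A) (q' : Q -> B), f \o p' = g \o q' ->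
    exists h : Q -> P, p \o h = p' /\ q \o h = q'.

Definition preserves_weak_pullbacks (T : setFunctor) : Prop :=
  forall (P A B C : SET) (p : P -> A) (q : P -> B) (f : A -> C) (g : B -> C),
    weak_pullback p q f g ->
    weak_pullback (smap T p) (smap T q) (smap T f) (smap T g).

Section FuzzyRelations.
Variable R : realType.

Definition fuzzy_pred (X : SET) := X -> {i01 R}.

Definition fuzzy_rel (A B : SET) := fuzzy_pred (A * B)%type.

Definition fle (X : SET) (f g : fuzzy_pred X) : Prop := forall x, f x <= g x.

Definition foplus (X : SET) (f g : fuzzy_pred X) : fuzzy_pred X :=
  fun x => oplus (f x) (g x).

Definition fzero (X : SET) : fuzzy_pred X := fun=> 0%:i01.

Definition fconv (A B : SET) (r : fuzzy_rel A B) : fuzzy_rel B A :=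
  fun ba => r (ba.2, ba.1).

Definition fcomp (A B C : SET) (r : fuzzy_rel A B) (s : fuzzy_rel B C) : fuzzy_rel A C :=
  fun ac => inf01 [set oplus (r (ac.1, b)) (s (b, ac.2)) | b in [set: B]].

Definition fuzzy_graph_eps (A B : SET) (e : {i01 R}) (f : A -> B) : fuzzy_rel A B :=
  fun ab => if `[< f ab.1 = ab.2 >] then e else 1%:i01.

Definition fuzzy_graph (A B : SET) (f : A -> B) : fuzzy_rel A B := fuzzy_graph_eps 0%:i01 f.

Definition fdiag (e : {i01 R}) (A : SET) : fuzzy_rel A A := fuzzy_graph_eps e (@id A).

Arguments fdiag e A : clear implicits.

Variable T : setFunctor.

Definition relLifting := forall A B : SET, fuzzy_rel A B -> fuzzy_rel (T A) (T B).

Definition preserves_converse (L : relLifting) : Prop :=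
  forall (A B : SET) (r : fuzzy_rel A B), L _ _ (fconv r) = fconv (L _ _ r).

Definition fuzzy_lax_extension (L : relLifting) : Prop :=
  [/\ forall (A B : SET) (r1 r2 : fuzzy_rel A B),
        fle r1 r2 -> fle (L _ _ r1) (L _ _ r2),
      forall (A B C : SET) (r : fuzzy_rel A B) (s : fuzzy_rel B C),
        fle (L _ _ (fcomp r s)) (fcomp (L _ _ r) (L _ _ s)) &
      forall (A B : SET) (f : A -> B),
        fle (L _ _ (fuzzy_graph f)) (fuzzy_graph (smap T f)) /\
        fle (L _ _ (fconv (fuzzy_graph f))) (fconv (fuzzy_graph (smap T f)))].

Definition nonexpansive_lifting (L : relLifting) : Prop :=
  forall (A : SET) (e : {i01 R}), 0%:i01 < e ->
    fle (L _ _ (fdiag e A)) (fdiag e (T A)).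

Record predLifting := PredLifting {
  plift :> forall X : SET, fuzzy_pred X -> fuzzy_pred (T X) ;
  plift_natural : forall (X Y : SET) (f : X -> Y) (g : fuzzy_pred Y),
    plift (g \o f) = plift g \o smap T f }.

Definition pl_monotone (l : predLifting) : Prop :=
  forall (X : SET) (f g : fuzzy_pred X), fle f g -> fle (l X f) (l X g).

Definition pl_subadditive (l : predLifting) : Prop :=
  forall (X : SET) (f g : fuzzy_pred X),
    fle (l X (foplus f g)) (foplus (l X f) (l X g)).

Definition pl_preserves_zero (l : predLifting) : Prop :=
  forall X : SET, l X (@fzero X) = @fzero (T X).

Definition pl_standard (l : predLifting) : Prop :=
  [/\ pl_monotone l, pl_subadditive l & pl_preserves_zero l].

(* [||f - g||_oo]; equal to 0 when [X] is empty, since [sup set0 = 0]. *)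
Definition supdist (X : SET) (f g : fuzzy_pred X) : R :=
  sup [set `|(f x)%:num - (g x)%:num| | x in [set: X]].

Definition pl_nonexpansive (l : predLifting) : Prop :=
  forall (X : SET) (f g : fuzzy_pred X), supdist (l X f) (l X g) <= supdist f g.

Definition couplings (A B : SET) (t1 : T A) (t2 : T B) : set (T (A * B)%type) :=
  [set t | smap T (@fst A B) t = t1 /\ smap T (@snd A B) t = t2].

(* [Lambda] has the type [set predLifting] unfolds to. Using [set] itself would
   force [SET] to lie strictly below the universe of [set] and [{i01 R}], hence
   exclude [{i01 R}] from the objects of [SET]. *)
Definition wasserstein (Lambda : predLifting -> Prop) : relLifting :=
  fun A B r t12 =>
    sup01 [set x | exists2 l : predLifting, Lambda l &
      inf01 [set l _ r t | t in couplings t12.1 t12.2] = x].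

End FuzzyRelations.

Arguments fuzzy_graph {R A B} f.
Arguments fuzzy_graph_eps {R A B} e f.
Arguments fdiag {R} e A.
Arguments fzero {R X}.

(* Main.v *)
Require Import Defs.
From mathcomp Require Import all_boot all_order all_algebra.
From mathcomp Require Import all_classical all_reals.
From mathcomp Require Import interval_inference.
From mathcomp Require Import lra.

(** Couplings [u] of [(t1, t2)] and [v] of [(t2, t3)] agree on [T B], and
    [A * B * C] is the pullback of [A * B] and [B * C] over [B]; as [T] preserves
    weak pullbacks, they glue to some [w] in [T (A * B * C)], whose projection to
    [T (A * C)] is a coupling of [(t1, t3)]. By naturality, monotonicity and
    subadditivity the cost of that coupling for [r ; s] is at most the cost of
    [u] plus the cost of [v], which gives (L2). For the graph of [f], the
    coupling [T <id, f> t] of [t] and [T f t] has cost [l 0 t = 0]; for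
    [Delta_e], the coupling [T <id, id> t] has cost [l e t], which is at most
    [e] by nonexpansiveness and [l 0 t = 0]. *)

Set Implicit Arguments.
Unset Strict Implicit.
Unset Printing Implicit Defensive.

Import Order.TTheory GRing.Theory Num.Theory.
Local Open Scope classical_set_scope.
Local Open Scope ring_scope.

Section UnitInterval.
Variable R : realType.
Implicit Types (x y z : {i01 R}) (S : set {i01 R}).

Lemma i01_ge0 x : (0%:i01 : {i01 R}) <= x.
Proof. by rewrite -num_le /=. Qed.

Lemma i01_le1 x : x <= (1%:i01 : {i01 R}).
Proof. by rewrite -num_le /=. Qed.

Lemma le_oplus x y z : (z <= oplus x y) = (z%:num <= x%:num + y%:num).
Proof.
have z1 : z%:num <= 1 := i01_le1 z.
by rewrite -num_le /= le_min z1 andbT.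
Qed.

Lemma oplusC x y : oplus x y = oplus y x.
Proof. by apply/val_inj; rewrite /= addrC. Qed.

Lemma le_oplus2r x y z : x <= y -> oplus x z <= oplus y z.
Proof.
rewrite -num_le => xy; rewrite -num_le /= le_min ge_min ge_min lexx orbT andbT.
by rewrite lerD2r xy.
Qed.

Lemma le_oplus2 x x' y y' : x <= x' -> y <= y' -> oplus x y <= oplus x' y'.
Proof.
move=> xx' yy'; apply: (le_trans (le_oplus2r y xx')).
by rewrite oplusC (oplusC x') le_oplus2r.
Qed.

(** Subtracting [x] in [R] turns the claim into: [z - x] is a lower bound of [S] with [1] adjoined.
    At the adjoined point this holds because [z <= 1] and [0 <= x], so an empty [S] needs no
    separate case. *)
Lemma le_oplus_inf01r z x S :
  (forall y, S y -> z <= oplus x y) -> z <= oplus x (inf01 S).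
Proof.
move=> zS; rewrite le_oplus -lerBlDl /=; apply: lb_le_inf; first by exists 1; left.
move=> _ [->|[y /zS + <-]]; last by rewrite le_oplus lerBlDl.
by rewrite lerBlDl ler_wpDl //; exact: i01_le1.
Qed.

Lemma le_oplus_inf01 z S S' :
  (forall x y, S x -> S' y -> z <= oplus x y) -> z <= oplus (inf01 S) (inf01 S').
Proof.
move=> zSS'; apply: le_oplus_inf01r => y S'y; rewrite oplusC.
by apply: le_oplus_inf01r => x Sx; rewrite oplusC; exact: zSS'.
Qed.

Lemma supdist_ub (X : SET) (f g : fuzzy_pred R X) (a : X) :
  `|(f a)%:num - (g a)%:num| <= supdist f g.
Proof.
apply: ub_le_sup; last by exists a.
exists 1 => _ [b _ <-].
have := i01_le1 (f b); have := i01_le1 (g b).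
have := i01_ge0 (f b); have := i01_ge0 (g b).
by rewrite -!num_le /= ler_norml => *; apply/andP; split; lra.
Qed.

Lemma supdist_cst0_le (X : SET) x : supdist (fun=> x : {i01 R}) (@fzero R X) <= x%:num.
Proof.
rewrite /supdist; set E := [set _ | _ in _].
(* For empty [X] the distance is [0], whatever [x] is; this is why only an inequality is claimed. *)
have [->|/set0P E0] := eqVneq E set0; first by rewrite sup0.
by apply: ge_sup => // _ [a _ <-]; rewrite /= subr0 ger0_norm.
Qed.

End UnitInterval.

Section Functor.
Variable T : setFunctor.

Lemma smap_compE (A B C : SET) (g : B -> C) (f : A -> B) t :
  smap T g (smap T f t) = smap T (g \o f) t.
Proof. by rewrite smap_comp. Qed.

Lemma smap_idE (A : SET) (t : T A) : smap T (@id A) t = t.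
Proof. by rewrite smap_id. Qed.

(** Testing the weak universal property on the one-point set turns it into a statement about
    elements. *)
Lemma weak_pullback_ex (P A B C : SET) (p : P -> A) (q : P -> B)
    (f : A -> C) (g : B -> C) a b :
  weak_pullback p q f g -> f a = g b -> exists c, p c = a /\ q c = b.
Proof.
move=> [_ pq] fg.
have [|h [ph qh]] := pq unit (fun=> a) (fun=> b); first by apply/funext.
by exists (h tt); split; [have := congr1 (@^~ tt) ph | have := congr1 (@^~ tt) qh].
Qed.

(** The mediating map takes its first two coordinates from [p] and the third from [q]; commutation
    of the square says that the two middle coordinates agree. *)
Lemma weak_pullback_triple (A B C : SET) :
  weak_pullback (fun w : A * B * C => w.1) (fun w => (w.1.2, w.2))
    (@snd A B) (@fst B C).
Proof.
split=> // Q p q pq; exists (fun x => (p x, (q x).2)); split=> //.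
apply/funext => x /=.
by have /= -> := congr1 (@^~ x) pq; case: (q x).
Qed.

Lemma couplings_glue (A B C : SET) (t1 : T A) (t2 : T B) (t3 : T C) u v :
  preserves_weak_pullbacks T -> couplings t1 t2 u -> couplings t2 t3 v ->
  exists w : T (A * B * C)%type,
    smap T (fun w => w.1) w = u /\ smap T (fun w => (w.1.2, w.2)) w = v.
Proof.
move=> hT [_ u2] [v1 _].
by apply: weak_pullback_ex (hT _ _ _ _ _ _ _ _ (@weak_pullback_triple A B C)) _; rewrite u2.
Qed.

Lemma couplings_graph (A B : SET) (f : A -> B) (t : T A) :
  couplings t (smap T f t) (smap T (fun a => (a, f a)) t).
Proof. by split; rewrite smap_compE // -[RHS]smap_idE. Qed.

Lemma couplings_swap (A B : SET) (t1 : T A) (t2 : T B) t :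
  couplings t1 t2 t -> couplings t2 t1 (smap T (fun ab => (ab.2, ab.1)) t).
Proof. by case=> p1 p2; split; rewrite smap_compE. Qed.

End Functor.

Section Wasserstein.
Variables (R : realType) (T : setFunctor).
Implicit Types (l : predLifting R T) (Lambda : predLifting R T -> Prop).

Lemma plift_smap l (X Y : SET) (f : X -> Y) (g : fuzzy_pred R Y) t :
  l Y g (smap T f t) = l X (g \o f) t.
Proof. by rewrite plift_natural. Qed.

(** The Wasserstein lifting of a single [l], with value [1] where no coupling exists. The estimates
    are proved for each [l] separately and then passed to the supremum. *)
Definition transport_cost l (A B : SET) (r : fuzzy_rel R A B) (t1 : T A) (t2 : T B) :=
  inf01 [set l _ r t | t in couplings t1 t2].

Lemma wasserstein_ub Lambda l (A B : SET) (r : fuzzy_rel R A B) t1 t2 :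
  Lambda l -> transport_cost l r t1 t2 <= wasserstein Lambda r (t1, t2).
Proof. by move=> Ll; apply: sup01_ub; exists l. Qed.

Lemma wasserstein_le Lambda (A B : SET) (r : fuzzy_rel R A B) t1 t2 x :
  (forall l, Lambda l -> transport_cost l r t1 t2 <= x) ->
  wasserstein Lambda r (t1, t2) <= x.
Proof. by move=> rx; apply: sup01_le => _ [l Ll <-]; exact: rx. Qed.

Lemma transport_cost_le l (A B : SET) (r : fuzzy_rel R A B) t1 t2 t :
  couplings t1 t2 t -> transport_cost l r t1 t2 <= l _ r t.
Proof. by move=> tt; apply: inf01_lb; exists t. Qed.

Lemma transport_cost_homo l (A B : SET) (r1 r2 : fuzzy_rel R A B) t1 t2 :
  pl_monotone l -> fle r1 r2 ->
  transport_cost l r1 t1 t2 <= transport_cost l r2 t1 t2.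
Proof.
move=> lm r12; apply: le_inf01 => _ [t tc <-].
exact: le_trans (transport_cost_le l r1 tc) (lm _ _ _ r12 t).
Qed.

Lemma transport_cost_comp l (A B C : SET) (r : fuzzy_rel R A B)
    (s : fuzzy_rel R B C) t1 t2 t3 :
  preserves_weak_pullbacks T -> pl_monotone l -> pl_subadditive l ->
  transport_cost l (fcomp r s) t1 t3 <=
    oplus (transport_cost l r t1 t2) (transport_cost l s t2 t3).
Proof.
move=> hT lm la; apply: le_oplus_inf01 => _ _ [u uc <-] [v vc <-].
have [w [wu wv]] := couplings_glue hT uc vc.
case: uc => u1 _; case: vc => _ v2.
have wc : couplings t1 t3 (smap T (fun w : A * B * C => (w.1.1, w.2)) w).
  by split; rewrite smap_compE -?u1 -?v2 -?wu -?wv smap_compE.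
apply: (le_trans (transport_cost_le l _ wc)).
rewrite -wu -wv !plift_smap.
(* All three costs are now values at the same [w]. What remains is an inequality at each triple,
   where the middle coordinate [b] is a candidate in the infimum defining [fcomp r s]. *)
apply: le_trans (la _ _ _ w); apply: lm => -[[a b] c] /=.
by apply: inf01_lb; exists b.
Qed.

Lemma transport_cost_graph_eps l (A B : SET) e (f : A -> B) t :
  transport_cost l (fuzzy_graph_eps e f) t (smap T f t) <= l A (fun=> e) t.
Proof.
apply: (le_trans (transport_cost_le l _ (couplings_graph f t))).
rewrite plift_smap; suff -> : fuzzy_graph_eps e f \o (fun a => (a, f a)) = fun=> e by [].
by apply/funext => a /=; rewrite /fuzzy_graph_eps; case: asboolP.
Qed.

(** Serves twice: [e = 0] gives (L3), and [f = id] gives nonexpansiveness. Off the graph of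
    [smap T f] the bound is [1]. *)
Lemma wasserstein_graph_eps Lambda (A B : SET) e (f : A -> B) :
  (forall l t, Lambda l -> l A (fun=> e) t <= e) ->
  fle (wasserstein Lambda (fuzzy_graph_eps e f)) (fuzzy_graph_eps e (smap T f)).
Proof.
move=> le [t1 t2]; rewrite [in leRHS]/fuzzy_graph_eps /=.
case: asboolP => [<-|_]; last exact: i01_le1.
apply: wasserstein_le => l Ll.
exact: le_trans (transport_cost_graph_eps l e f t1) (le l t1 Ll).
Qed.

Lemma transport_cost_conv_le l (A B : SET) (r : fuzzy_rel R A B) t1 t2 :
  transport_cost l (fconv r) t2 t1 <= transport_cost l r t1 t2.
Proof.
apply: le_inf01 => _ [t tc <-].
apply: (le_trans (transport_cost_le l _ (couplings_swap tc))).
rewrite plift_smap; suff -> : fconv r \o (fun ab => (ab.2, ab.1)) = r by [].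
by apply/funext => -[].
Qed.

Lemma fconvK (A B : SET) (r : fuzzy_rel R A B) : fconv (fconv r) = r.
Proof. by apply/funext => -[]. Qed.

Lemma wasserstein_conv Lambda : preserves_converse (wasserstein Lambda).
Proof.
(* One inequality, for all relations, is enough: since [fconv] is an involution, applying it to
   [fconv r] gives the reverse one. *)
have conv_le A B (r : fuzzy_rel R A B) t1 t2 :
    wasserstein Lambda (fconv r) (t2, t1) <= wasserstein Lambda r (t1, t2).
  apply: wasserstein_le => l Ll.
  exact: le_trans (transport_cost_conv_le l r t1 t2) (wasserstein_ub r t1 t2 Ll).
move=> A B r; apply/funext => -[t2 t1]; apply/le_anti/andP; split; first exact: conv_le.
by rewrite /fconv /= -[in leLHS](fconvK r); exact: conv_le.
Qed.

Lemma wasserstein_lax_extension Lambda :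
  preserves_weak_pullbacks T -> (forall l, Lambda l -> pl_standard l) ->
  fuzzy_lax_extension (wasserstein Lambda).
Proof.
move=> hT std.
have graph_le (A B : SET) (f : A -> B) :
    fle (wasserstein Lambda (fuzzy_graph f)) (fuzzy_graph (smap T f)).
  apply: wasserstein_graph_eps => l t /std[_ _ l0].
  by have -> := congr1 (@^~ t) (l0 A).
split.
- move=> A B r1 r2 r12 [t1 t2]; apply: wasserstein_le => l Ll.
  have [lm _ _] := std _ Ll.
  exact: le_trans (transport_cost_homo t1 t2 lm r12) (wasserstein_ub r2 t1 t2 Ll).
- move=> A B C r s [t1 t3]; apply: le_inf01 => _ [t2 _ <-].
  (* The same [l] is used for both relations on the right, and each of its two costs lies below the
     corresponding supremum. *)
  apply: wasserstein_le => l Ll; have [lm la _] := std _ Ll.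
  apply: (le_trans (transport_cost_comp r s t1 t2 t3 hT lm la)).
  by apply: le_oplus2; exact: wasserstein_ub.
- move=> A B f; split; first exact: graph_le.
  by rewrite wasserstein_conv => -[t2 t1]; exact: (graph_le A B f (t1, t2)).
Qed.

Lemma pl_nonexpansive_cst_le l (A : SET) (e : {i01 R}) t :
  pl_nonexpansive l -> pl_preserves_zero l -> l A (fun=> e) t <= e.
Proof.
move=> ln l0; have := supdist_ub (l A (fun=> e)) (l A fzero) t.
have -> : (l A fzero t)%:num = 0 by rewrite l0.
rewrite subr0 ger0_norm // => le_dist; rewrite -num_le.
exact: le_trans le_dist (le_trans (ln _ _ _) (supdist_cst0_le A e)).
Qed.

Lemma wasserstein_nonexpansive Lambda :
  (forall l, Lambda l -> pl_preserves_zero l) ->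
  (forall l, Lambda l -> pl_nonexpansive l) ->
  nonexpansive_lifting (wasserstein Lambda).
Proof.
(* The identity of [T A] is rewritten as [smap T id], so that the target becomes a graph of the form
   [smap T f]. *)
move=> zero nexp A e _; rewrite /fdiag -(smap_id T A).
apply: wasserstein_graph_eps => l t Ll.
exact: pl_nonexpansive_cst_le (nexp _ Ll) (zero _ Ll).
Qed.

End Wasserstein.

Theorem theorem6p7 (R : realType) (T : setFunctor)
  (hT : preserves_weak_pullbacks T)
  (Lambda : predLifting R T -> Prop)
  (hLambda : forall l, Lambda l -> pl_standard l) :
  [/\ fuzzy_lax_extension (wasserstein Lambda),
      preserves_converse (wasserstein Lambda) &
      (forall l, Lambda l -> pl_nonexpansive l) ->
      nonexpansive_lifting (wasserstein Lambda)].
Proof.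
split; [exact: wasserstein_lax_extension | exact: wasserstein_conv |].
by apply: wasserstein_nonexpansive => l /hLambda[].
Qed.
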